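(* (Narrow region principle.) Let $\alpha\in(0,2)$ and $\lambda\in\mathbb{R}$. Let $\Omega_1$ be a bounded narrow region in $\{x\in H_\lambda : x_n\ge0\}$, such that it is contained in $\{x\in\mathbb{R}^n : x_n\ge0,\ \lambda-l<x_1<\lambda\}$ with small $l$, and let $\Omega_2\subset\{x\in H_\lambda : x_n<0\}$. Assume that $w\in L_\alpha\cap C^{1,\theta}_{loc}(\mathbb{R}^n)$ for some $\theta>\max\{0,\alpha-1\}$. Suppose that $a(x)$ is bounded from below in $\Omega_1$ and that $$\begin{cases}(-\Delta)^{\frac{\alpha}{2}}w(x)+a(x)w(x)\ge0, & x\in\Omega_1,\\ \mathcal{N}_{\frac{\alpha}{2}}w(x)\ge0, & x\in\Omega_2,\\ w(x)\ge0, & x\in H_\lambda\setminus(\Omega_1\cup\Omega_2),\\ w(x^\lambda)=-w(x), & x\in H_\lambda.\end{cases}$$ Then for sufficiently small $l$, we have $$w(x)\ge0,\qquad x\in\Omega_1.$$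
   Context: $\mathbb{R}^n_+=\{x=(x_1,\dots,x_n)\in\mathbb{R}^n : x_n>0\}$. The $x_1$ direction is any chosen direction in $\mathbb{R}^{n-1}$, where $\mathbb{R}^n_+=\mathbb{R}^{n-1}\times(0,\infty)$ (so it is tangential to $\partial\mathbb{R}^n_+$ and distinct from the $x_n$ direction). For $\lambda\in\mathbb{R}$, $H_\lambda=\{x\in\mathbb{R}^n : x_1<\lambda\}$ and $x^\lambda=(2\lambda-x_1,x_2,\dots,x_n)$ is the reflection of $x$ in the hyperplane $\{x_1=\lambda\}$. The fractional Laplacian is $$(-\Delta)^{\frac{\alpha}{2}}w(x)=C_{n,\alpha}\lim_{\epsilon\to0}\int_{\mathbb{R}^n\setminus B_\epsilon(x)}\frac{w(x)-w(y)}{|x-y|^{n+\alpha}}\,dy,$$ where $C_{n,\alpha}$ is a normalization constant. The nonlocal normal derivative is $$\mathcal{N}_{\frac{\alpha}{2}}w(x)=C_{n,\alpha}\int_{\mathbb{R}^n_+}\frac{w(x)-w(y)}{|x-y|^{n+\alpha}}\,dy,\qquad x\in\mathbb{R}^n\setminus\overline{\mathbb{R}^n_+}\ (\text{i.e. } x_n<0).$$ $L_\alpha=\left\{w:\mathbb{R}^n\to\mathbb{R} : \int_{\mathbb{R}^n}\frac{|w(x)|}{1+|x|^{n+\alpha}}\,dx<\infty\right\}$. *)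

(* Defs.v *)
From HB Require Import structures.
From mathcomp Require Import all_boot all_order all_algebra.
From mathcomp Require Import all_classical all_reals all_analysis.

Set Implicit Arguments.
Unset Strict Implicit.
Unset Printing Implicit Defensive.

Import Order.TTheory GRing.Theory Num.Theory.
Import numFieldNormedType.Exports.

Local Open Scope classical_set_scope.
Local Open Scope ring_scope.

(* R^n is 'rV[R]_n with the library's topology. The library norm `|x| on it is
   the sup norm, hence the separate Euclidean norm [enorm] below. The
   sigma-algebra generated by the coordinates is the Borel one. *)

Section measurable_rV.
Context {R : realType} (n : nat).

Let coors : 'I_n -> 'rV[R]_n -> measurableTypeR R := fun i x => x ord0 i.

Let rV_set0 : g_sigma_preimage coors set0.
Proof. exact: sigma_algebra0. Qed.

Let rV_setC A : g_sigma_preimage coors A -> g_sigma_preimage coors (~` A).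
Proof. exact: sigma_algebraC. Qed.

Let rV_bigcup (F : (set 'rV[R]_n)^nat) :
  (forall i, g_sigma_preimage coors (F i)) ->
  g_sigma_preimage coors (\bigcup_i (F i)).
Proof. exact: sigma_algebra_bigcup. Qed.

HB.instance Definition _ := @isMeasurable.Build default_measure_display
  'rV[R]_n (g_sigma_preimage coors) rV_set0 rV_setC rV_bigcup.

End measurable_rV.

Section measurable_rV_lemmas.
Context {R : realType}.

Lemma measurable_coord n (i : 'I_n) :
  measurable_fun [set: 'rV[R]_n] (fun x : 'rV[R]_n => x ord0 i : measurableTypeR R).
Proof.
move=> _ Y mY; rewrite setTI; apply: sub_sigma_algebra => /=.
rewrite -bigcup_seq/=; exists i => /=; first by rewrite mem_index_enum.
by exists Y => //; rewrite setTI.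
Qed.

Lemma measurable_fun_rVP d (T : measurableType d) n (f : T -> 'rV[R]_n) :
  measurable_fun [set: T] f <->
  forall i, measurable_fun [set: T] (fun t => f t ord0 i : measurableTypeR R).
Proof.
split=> [mf i|mf].
  exact: (measurableT_comp (@measurable_coord n i) mf).
apply: (@iffRL _ (g_sigma_preimage
    (fun i t => f t ord0 i : measurableTypeR R) `<=` measurable)).
  rewrite (g_sigma_preimage_comp
    (fun i (x : 'rV[R]_n) => x ord0 i : measurableTypeR R)).
  split=> [mf' A [/= C preC <-]|prefS]; first exact: mf'.
  by move=> _ A mA; apply: prefS; exists A.
apply: smallest_sub; first exact: sigma_algebra_measurable.
case: n => [|n] in f mf *; first by rewrite big_ord0.
rewrite -bigcup_mkord_ord; apply: bigcup_sub => i Ii.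
by move=> A [B mB <-]; exact: mf.
Qed.

Definition consrV n (p : measurableTypeR R * 'rV[R]_n) : 'rV[R]_n.+1 :=
  row_mx (const_mx p.1 : 'rV[R]_1) p.2.

Definition unconsrV n (x : 'rV[R]_n.+1) : measurableTypeR R * 'rV[R]_n :=
  (x ord0 ord0, rsubmx (x : 'rV[R]_(1 + n))).

Lemma consrVK n : cancel (@consrV n) (@unconsrV n).
Proof.
move=> -[a v]; rewrite /unconsrV /consrV /= row_mxKr; congr pair.
have -> : ord0 = lshift n ord0 :> 'I_(1 + n) by exact: val_inj.
by apply: etrans (row_mxEl _ _ _ _) _; rewrite mxE.
Qed.

Lemma measurable_consrV n : measurable_fun [set: _] (@consrV n).
Proof.
apply/measurable_fun_rVP => i.
have [j ji|j ji] := @split_ordP 1 n i.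
- rewrite (_ : (fun _ => _) = fst)//; apply/funext => p /=.
  by rewrite ji; apply: etrans (row_mxEl _ _ _ _) _; rewrite mxE.
- rewrite (_ : (fun _ => _) =
    (fun x : 'rV[R]_n => x ord0 j : measurableTypeR R) \o snd); last first.
    by apply/funext => p /=; rewrite ji; exact: row_mxEr.
  by apply: measurableT_comp => //; exact: measurable_coord.
Qed.

HB.instance Definition _ n :=
  isMeasurableFun.Build _ _ _ _ (@consrV n) (@measurable_consrV n).

Lemma measurable_unconsrV n : measurable_fun [set: _] (@unconsrV n).
Proof.
apply/measurable_fun_pairP; split; first exact: measurable_coord.
apply/measurable_fun_rVP => i /=.
rewrite (_ : (fun _ => _) =
  fun x : 'rV[R]_n.+1 => x ord0 (rshift 1 i) : measurableTypeR R).
  exact: measurable_coord.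
by apply/funext => x /=; rewrite mxE.
Qed.

End measurable_rV_lemmas.

Section lebesgue_rV_succ.
Context {R : realType} (n : nat)
  (mu : {sigma_finite_measure set 'rV[R]_n -> \bar R}).
Local Open Scope ereal_scope.

Definition lebesgue_rV_succ : set 'rV[R]_n.+1 -> \bar R :=
  pushforward ((@lebesgue_measure R) \x mu) (@consrV R n).

Let lebesgue_rV_succ0 : lebesgue_rV_succ set0 = 0.
Proof. exact: measure0. Qed.

Let lebesgue_rV_succ_ge0 A : 0 <= lebesgue_rV_succ A.
Proof. exact: measure_ge0. Qed.

Let lebesgue_rV_succ_sigma_additive : semi_sigma_additive lebesgue_rV_succ.
Proof. exact: measure_semi_sigma_additive. Qed.

HB.instance Definition _ := isMeasure.Build _ _ _ lebesgue_rV_succ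
  lebesgue_rV_succ0 lebesgue_rV_succ_ge0 lebesgue_rV_succ_sigma_additive.

Let lebesgue_rV_succ_sigma_finite : sigma_finite setT lebesgue_rV_succ.
Proof.
have /sigma_finiteP[F [TF ndF Foo]] := sigma_finiteT (@lebesgue_measure R).
have /sigma_finiteP[G [TG ndG Goo]] := sigma_finiteT mu.
exists (fun k => @unconsrV R n @^-1` (F k `*` G k)).
  apply/esym; rewrite -preimage_bigcup -subTset => x _ /=.
  have : (\bigcup_i F i) (unconsrV x).1 by rewrite -TF.
  have : (\bigcup_i G i) (unconsrV x).2 by rewrite -TG.
  move=> [j _ Gj] [i _ Fi]; exists (maxn i j) => //; split.
  - by move: Fi; exact/subsetPset/ndF/leq_maxl.
  - by move: Gj; exact/subsetPset/ndG/leq_maxr.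
move=> k; have [mF Fk] := Foo k; have [mG Gk] := Goo k; split.
  rewrite -[X in measurable X]setTI; apply: measurable_unconsrV => //.
  exact: measurableX.
rewrite /lebesgue_rV_succ /pushforward -comp_preimage.
rewrite (_ : _ \o _ = id); last by apply/funext => p /=; exact: consrVK.
by rewrite preimage_id product_measure1E// lte_mul_pinfty// ge0_fin_numE.
Qed.

HB.instance Definition _ := Measure_isSigmaFinite.Build _ _ _ lebesgue_rV_succ
  lebesgue_rV_succ_sigma_finite.

End lebesgue_rV_succ.

(* The n-dimensional Lebesgue measure, as an iterated product measure. *)
Fixpoint lebesgue_rV {R : realType} (n : nat) :
    {sigma_finite_measure set 'rV[R]_n -> \bar R} :=
  if n is n'.+1 then lebesgue_rV_succ (lebesgue_rV n')
  else dirac (0 : 'rV[R]_0).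

Section nonlocal.
Context {R : realType}.

Definition enorm n (x : 'rV[R]_n) : R :=
  Num.sqrt (\sum_(i < n) x ord0 i ^+ 2).

Definition eball n (x : 'rV[R]_n) (r : R) : set 'rV[R]_n :=
  [set y | enorm (y - x) < r].

(* x_1 and x_n for x in R^n; these are distinct coordinates when n >= 2. *)
Definition fst_coord n (x : 'rV[R]_n.+1) : R := x ord0 ord0.
Definition lst_coord n (x : 'rV[R]_n.+1) : R := x ord0 ord_max.

Definition upper_half n : set 'rV[R]_n.+1 := [set x | 0 < lst_coord x].

Definition Hlt n (lambda : R) : set 'rV[R]_n.+1 :=
  [set x | fst_coord x < lambda].

Definition reflect_fst n (lambda : R) (x : 'rV[R]_n.+1) : 'rV[R]_n.+1 :=
  \row_i (if i == ord0 then 2 * lambda - fst_coord x else x ord0 i).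

Definition nonlocal_quot n (alpha : R) (w : 'rV[R]_n -> R) (x y : 'rV[R]_n) : R :=
  (w x - w y) / enorm (x - y) `^ (n%:R + alpha).

(* [c] is the normalization constant C_{n,alpha}. [lim] is a total function;
   the limit exists at every point when w is in L_alpha and in
   C^{1,theta}_loc with theta > max(0, alpha - 1). *)
Definition frac_laplacian n (c alpha : R) (w : 'rV[R]_n -> R) (x : 'rV[R]_n) : R :=
  c * lim ((\int[lebesgue_rV n]_(y in ~` eball x e) nonlocal_quot alpha w x y)
           @[e --> 0^'+]).

Definition nonlocal_normal n (c alpha : R) (w : 'rV[R]_n.+1 -> R)
    (x : 'rV[R]_n.+1) : R :=
  c * \int[lebesgue_rV n.+1]_(y in @upper_half n) nonlocal_quot alpha w x y.

Definition in_Lalpha n (alpha : R) (w : 'rV[R]_n -> R) : Prop :=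
  measurable_fun [set: 'rV[R]_n] (w : _ -> measurableTypeR R) /\
  (\int[lebesgue_rV n]_x
     (`|w x| / (1 + enorm x `^ (n%:R + alpha)))%:E < +oo)%E.

Definition gradient n (w : 'rV[R]_n -> R) (x : 'rV[R]_n) : 'rV[R]_n :=
  \row_i 'D_(delta_mx ord0 i) w x.

Definition in_C1theta_loc n (theta : R) (w : 'rV[R]_n -> R) : Prop :=
  [/\ forall x, differentiable w x,
      continuous (gradient w) &
      forall K : set 'rV[R]_n, compact K -> exists M : R,
        forall x y, K x -> K y ->
          enorm (gradient w x - gradient w y) <= M * enorm (x - y) `^ theta].

End nonlocal.

(* Main.v *)
(* If w is negative somewhere in Omega1, it attains its minimum over the closure
   of Omega1 at a point x0, and the sign conditions and w = 0 on the hyperplane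
   {x_1 = lambda} force x0 to lie in Omega1. On Omega2 the condition on the
   nonlocal normal derivative, folded along the hyperplane by antisymmetry,
   prevents w from going below w x0, so x0 minimizes w over the half space
   H = {x_1 < lambda}. Folding the fractional Laplacian in the same way gives
   frac_laplacian w x0 <= c * w x0 * k, where k is the integral of the kernel
   over the complement of H. A cube of side d = lambda - x0_1 < l at distance
   of order d from x0 shows that k is at least a constant times d `^ - alpha,
   which exceeds - m / c when l is small: then frac_laplacian w x0 + a x0 * w x0
   is negative. *)
Require Import Defs.
From HB Require Import structures.
From mathcomp Require Import all_boot all_order all_algebra.
From mathcomp Require Import all_classical all_reals all_analysis.
From mathcomp Require Import measurable_realfun.
From mathcomp Require Import lra ring.

Set Implicit Arguments.
Unset Strict Implicit.
Unset Printing Implicit Defensive.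

Import Order.TTheory GRing.Theory Num.Theory.
Import numFieldNormedType.Exports.

Local Open Scope classical_set_scope.
Local Open Scope ring_scope.

(** * Lebesgue measure on row vectors: volumes of cubes and invariance under reflection *)

Section lebesgue_rV_facts.
Context {R : realType}.

Lemma ball_rVP n (x y : 'rV[R]_n) (r : R) : 0 < r ->
  ball x r y <-> forall i, `|x ord0 i - y ord0 i| < r.
Proof.
move=> r0; split=> [[_ H] i|H]; first exact: (H ord0 i).
by split => // i j; rewrite (ord1 i); exact: H.
Qed.

Lemma measurable_ball_rV n (x : 'rV[R]_n) (r : R) : measurable (ball x r).
Proof.
have [r0|r0] := leP r 0.
  suff -> : ball x r = set0 by [].
  by apply/seteqP; split => // y /= [+ _]; rewrite ltNge r0.
have -> : ball x r = \bigcap_(i in [set: 'I_n])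
    ((fun y : 'rV[R]_n => y ord0 i : measurableTypeR R)
       @^-1` `](x ord0 i - r), (x ord0 i + r)[).
  apply/seteqP; split => y; rewrite /= ball_rVP//= => H i.
    by move=> _ /=; have := H i; rewrite in_itv/= ltr_norml; lra.
  by have := H i Logic.I; rewrite /= in_itv/= ltr_norml; lra.
apply: fin_bigcap_measurable => [|i _]; first exact: finite_finset.
by rewrite -[X in measurable X]setTI; exact: measurable_coord.
Qed.

Lemma consrV0 n (p : measurableTypeR R * 'rV[R]_n) : consrV p ord0 ord0 = p.1.
Proof. exact: (congr1 fst (consrVK p)). Qed.

Lemma consrVS n (p : measurableTypeR R * 'rV[R]_n) (i : 'I_n) :
  consrV p ord0 (lift ord0 i) = p.2 ord0 i.
Proof. by rewrite -rshift1; exact: row_mxEr. Qed.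

(** Balls for the sup norm are cubes: each splits into an interval in the first coordinate times a
    ball one dimension lower, and the product measure multiplies the sides. *)
Lemma lebesgue_rV_ball n (x : 'rV[R]_n) (r : R) : 0 < r ->
  lebesgue_rV n (ball x r) = ((2 * r) ^+ n)%:E.
Proof.
move=> r0; elim: n x => [|n IH] x.
  by rewrite /= expr0 diracE mem_set//; apply/ball_rVP => // -[].
rewrite /= /lebesgue_rV_succ /pushforward.
have -> : @consrV R n @^-1` ball x r =
  `](x ord0 ord0 - r), (x ord0 ord0 + r)[ `*` ball (\row_i x ord0 (lift ord0 i)) r.
  apply/seteqP; split => -[t y]; rewrite /= in_itv/= !ball_rVP// => H.
    split.
      by have := H ord0; rewrite consrV0 ltr_norml /=; lra.
    by move=> i; have := H (lift ord0 i); rewrite consrVS mxE.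
  move=> i; have [j ->|->] := unliftP ord0 i.
    by rewrite consrVS; case: H => _ /(_ j); rewrite mxE.
  by rewrite consrV0 ltr_norml /=; lra.
rewrite product_measure1E//; last exact: measurable_ball_rV.
rewrite IH.
rewrite exprS EFinM; congr (_ * _)%E.
apply: (etrans (lebesgue_measure_itv `](x ord0 ord0 - r), (x ord0 ord0 + r)[)).
rewrite /= lte_fin ifT; last lra.
by rewrite -EFinB; congr (_%:E); lra.
Qed.

Lemma measurable_reflect_fst n (lambda : R) :
  measurable_fun setT (@reflect_fst R n lambda).
Proof.
apply/measurable_fun_rVP => i.
have [->|i0] := eqVneq i ord0.
  rewrite (_ : (fun _ => _) = fun x : 'rV[R]_n.+1 => 2 * lambda - x ord0 ord0); last first.
    by apply/funext => x; rewrite mxE eqxx.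
  by apply: measurable_funB => //; exact: measurable_coord.
rewrite (_ : (fun _ => _) = fun x : 'rV[R]_n.+1 => x ord0 i).
  exact: measurable_coord.
by apply/funext => x; rewrite mxE (negbTE i0).
Qed.

(** By uniqueness of Lebesgue measure it suffices to compare on half-open intervals. The reflection
    swaps the open and the closed end and keeps the length. *)
Lemma lebesgue_measure_reflect (lambda : R) (A : set (measurableTypeR R)) :
  measurable A ->
  lebesgue_measure
    ((fun t : measurableTypeR R => 2 * lambda - t : measurableTypeR R) @^-1` A) =
  lebesgue_measure A.
Proof.
move=> mA.
pose f := (fun t : measurableTypeR R => 2 * lambda - t : measurableTypeR R).
have mf : measurable_fun setT f by exact: measurable_funB.
pose f_mfun : {mfun _ >-> _} := HB.pack f (isMeasurableFun.Build _ _ _ _ _ mf).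
rewrite [RHS](@lebesgue_measure_unique R (pushforward lebesgue_measure f_mfun))//.
move=> _ [[a b]] _ <-; rewrite /= /pushforward.
have -> : f @^-1` `]a, b] = `[2 * lambda - b, 2 * lambda - a[%classic.
  apply/seteqP; split=> t; rewrite /= !in_itv/= /f => /andP[h1 h2];
    apply/andP; split; lra.
rewrite !lebesgue_measure_itv/= !lte_fin ltrD2l ltrN2; case: ifP => // _.
by rewrite -EFinB; congr (_%:E); lra.
Qed.

(** Through [consrV] the reflection acts on the first factor alone, so uniqueness of the product
    measure reduces the claim to rectangles and hence to the line. *)
Lemma lebesgue_rV_reflect n (lambda : R) (A : set 'rV[R]_n.+1) : measurable A ->
  lebesgue_rV n.+1 (reflect_fst lambda @^-1` A) = lebesgue_rV n.+1 A.
Proof.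
move=> mA; rewrite /= /lebesgue_rV_succ /pushforward.
pose f (p : measurableTypeR R * 'rV[R]_n) : measurableTypeR R * 'rV[R]_n :=
  (2 * lambda - p.1, p.2).
have mf : measurable_fun setT f.
  apply/measurable_fun_pairP; split; last exact: measurable_snd.
  by apply: measurable_funB => //; exact: measurable_fst.
pose f_mfun : {mfun _ >-> _} := HB.pack f (isMeasurableFun.Build _ _ _ _ _ mf).
have mB : measurable (@consrV R n @^-1` A).
  by rewrite -[X in measurable X]setTI; apply: measurable_consrV.
rewrite [RHS](@product_measure_unique _ _ _ _ _ lebesgue_measure (lebesgue_rV n)
  (pushforward (lebesgue_measure \x lebesgue_rV n)%E f_mfun))//.
  suff E : reflect_fst lambda \o @consrV R n = @consrV R n \o f.
    by rewrite -comp_preimage E.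
  apply/funext => p; apply/rowP => i /=; rewrite mxE.
  have [j ->|->] := unliftP ord0 i; first by rewrite /= !consrVS.
  by rewrite /= /fst_coord !consrV0.
move=> A' B' mA' mB'; rewrite /pushforward /=.
pose g := fun t : measurableTypeR R => 2 * lambda - t : measurableTypeR R.
have mgA' : measurable (g @^-1` A').
  by rewrite -[X in measurable X]setTI; exact: measurable_funB.
rewrite -(lebesgue_measure_reflect lambda mA').
exact: (product_measure1E lebesgue_measure (lebesgue_rV n) mgA' mB').
Qed.
End lebesgue_rV_facts.

(** * The Euclidean norm compared with the coordinates *)

Section euclidean_norm.
Context {R : realType}.

Lemma enorm_ge0 n (x : 'rV[R]_n) : 0 <= enorm x.
Proof. exact: sqrtr_ge0. Qed.

Lemma ler_norm_enorm n (x : 'rV[R]_n) i : `|x ord0 i| <= enorm x.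
Proof.
rewrite -sqrtr_sqr ler_wsqrtr// (bigD1 i)//= lerDl sumr_ge0// => j _.
exact: sqr_ge0.
Qed.

(** The crude factor [n%:R], from [n <= n ^ 2], replaces the square root of [n]; the later estimates
    only need some finite constant. *)
Lemma enorm_le n (x : 'rV[R]_n) (r : R) : 0 <= r ->
  (forall i, `|x ord0 i| <= r) -> enorm x <= n%:R * r.
Proof.
move=> r0 xr; rewrite -[leRHS]ger0_norm ?mulr_ge0// -sqrtr_sqr ler_wsqrtr//.
have h i : x ord0 i ^+ 2 <= r ^+ 2.
  by rewrite -real_normK ?num_real// lerXn2r ?nnegrE.
apply: (@le_trans _ _ (n%:R * r ^+ 2)).
  rewrite mulr_natl -[X in _ *+ X](card_ord n) -sumr_const.
  by apply: ler_sum.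
rewrite exprMn ler_wpM2r ?sqr_ge0// -natrX ler_nat.
by case: (n) => // k; rewrite -mulnn leq_pmulr.
Qed.

Lemma enormN n (x : 'rV[R]_n) : enorm (- x) = enorm x.
Proof. by congr Num.sqrt; apply: eq_bigr => i _; rewrite mxE sqrrN. Qed.

Lemma enormBC n (x y : 'rV[R]_n) : enorm (x - y) = enorm (y - x).
Proof. by rewrite -enormN opprB. Qed.

Lemma enorm_eq0 n (x : 'rV[R]_n) : (enorm x == 0) = (x == 0).
Proof.
apply/eqP/eqP => [x0|->].
  apply/rowP => i; apply/eqP; rewrite mxE.
  by rewrite -normr_le0 -[leRHS]x0 ler_norm_enorm.
by rewrite /enorm big1 ?sqrtr0// => i _; rewrite mxE expr0n.
Qed.

Lemma enorm_gt0 n (x : 'rV[R]_n) : (0 < enorm x) = (x != 0).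
Proof. by rewrite lt0r enorm_eq0 enorm_ge0 andbT. Qed.

Lemma enormZ n (a : R) (x : 'rV[R]_n) : enorm (a *: x) = `|a| * enorm x.
Proof.
rewrite /enorm -sqrtr_sqr -sqrtrM ?sqr_ge0// mulr_sumr; congr Num.sqrt.
by apply: eq_bigr => i _; rewrite mxE exprMn.
Qed.

Lemma measurable_enormB n (x : 'rV[R]_n) :
  measurable_fun [set: 'rV[R]_n] (fun y => enorm (x - y) : measurableTypeR R).
Proof.
apply: (measurableT_comp (f := Num.sqrt : measurableTypeR R -> measurableTypeR R)).
  by apply: continuous_measurable_fun; exact: sqrt_continuous.
apply: measurable_sum => i; apply: measurable_funX.
rewrite (_ : (fun _ => _) = (fun y : 'rV[R]_n => x ord0 i - y ord0 i)).
  by apply: measurable_funB => //; exact: measurable_coord.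
by apply/funext => y; rewrite !mxE.
Qed.

Lemma measurable_eball n (x : 'rV[R]_n) r : measurable (eball x r).
Proof.
rewrite (_ : eball x r = (fun y => enorm (x - y)) @^-1` `]-oo, r[).
  by rewrite -[X in measurable X]setTI; apply: measurable_enormB.
by apply/seteqP; split => y; rewrite /eball/= in_itv/= enormBC.
Qed.

Lemma eball_sub_ball n (x : 'rV[R]_n) r : eball x r `<=` ball x r.
Proof.
move=> y; rewrite /eball/= => xyr.
have r0 : 0 < r by exact: le_lt_trans (enorm_ge0 _) xyr.
apply/ball_rVP => // i; rewrite distrC; apply: le_lt_trans xyr.
by have := ler_norm_enorm (y - x) i; rewrite !mxE.
Qed.

End euclidean_norm.

(** * Signs of integrals and measure-preserving maps *)

Lemma Rintegral_le0 d (T : measurableType d) (R : realType)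
    (mu : {measure set T -> \bar R}) (D : set T) (f : T -> R) : measurable D ->
  mu.-integrable D (EFin \o f) -> (forall x, D x -> f x <= 0) ->
  \int[mu]_(x in D) f x <= 0.
Proof.
move=> mD intf f0; rewrite -[leRHS](mul0r (fine (mu D))) -Rintegral_cst//.
by apply: le_Rintegral => //; exact: integrable0.
Qed.

Section measure_preserving.
Context d (T : measurableType d) (R : realType) (mu : {measure set T -> \bar R}).
Context (rho : T -> T) (mrho : measurable_fun [set: T] rho)
  (mu_rho : forall A, measurable A -> mu (rho @^-1` A) = mu A).

Let integral_pushforwardE (g : T -> \bar R) :
  (\int[mu]_y g y = \int[pushforward mu rho]_y g y)%E.
Proof. by apply: eq_measure_integral => A mA _; exact/esym/mu_rho. Qed.

Lemma integrable_measure_preserving (f : T -> \bar R) :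
  mu.-integrable [set: T] f -> mu.-integrable [set: T] (f \o rho).
Proof.
move=> /integrableP[mf foo]; apply/integrableP; split; first exact: measurableT_comp.
move: foo; rewrite integral_pushforwardE ge0_integral_pushforward//.
exact: measurableT_comp.
Qed.

Lemma integral_measure_preserving (f : T -> \bar R) :
  mu.-integrable [set: T] f ->
  (\int[mu]_y f (rho y) = \int[mu]_y f y)%E.
Proof.
move=> intf; have mf := measurable_int mu intf.
rewrite [RHS]integral_pushforwardE integral_pushforward//.
by rewrite preimage_setT; exact: integrable_measure_preserving.
Qed.

(** Since [h] and [h \o rho] have the same integral, twice the integral of [h] is the integral of
    their sum. *)
Lemma Rintegral_symmetrized_le0 (h : T -> R) :
  mu.-integrable [set: T] (EFin \o h) ->
  (forall y, h y + h (rho y) <= 0) -> \int[mu]_y h y <= 0.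
Proof.
move=> inth hle.
have inthr := integrable_measure_preserving inth.
have : \int[mu]_y (h y + h (rho y)) <= 0.
  by apply: Rintegral_le0 => //; exact: (integrableD _ inth inthr).
rewrite RintegralD//.
rewrite (_ : \int[mu]_y h (rho y) = \int[mu]_y h y); first lra.
by congr fine; exact: (integral_measure_preserving inth).
Qed.

End measure_preserving.

(** * Geometry of the reflection in the hyperplane *)

Section reflection.
Context {R : realType} (n : nat) (lambda : R).
Implicit Types (x y : 'rV[R]_n.+1).

Local Notation rho := (@reflect_fst R n lambda).
Local Notation H := (@Hlt R n lambda).

Lemma reflect_fst0 y : rho y ord0 ord0 = 2 * lambda - y ord0 ord0.
Proof. by rewrite mxE eqxx. Qed.

Lemma reflect_fstS y i : rho y ord0 (lift ord0 i) = y ord0 (lift ord0 i).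
Proof. by rewrite mxE. Qed.

Lemma reflect_fstK : involutive rho.
Proof.
move=> y; apply/rowP => i; have [j ->|->] := unliftP ord0 i.
  by rewrite !reflect_fstS.
by rewrite !reflect_fst0; lra.
Qed.

Lemma reflect_fst_fixed y : fst_coord y = lambda -> rho y = y.
Proof.
rewrite /fst_coord => yl; apply/rowP => i; have [j ->|->] := unliftP ord0 i.
  by rewrite !reflect_fstS.
by rewrite !reflect_fst0; lra.
Qed.

(** Only the first coordinate changes: with [a = lambda - x_1] and [b = lambda - y_1], the squares
    [(a + b) ^+ 2] and [(a - b) ^+ 2] differ by [4 * a * b > 0]. *)
Lemma enorm_reflect_le x y : H x -> H y -> enorm (x - y) <= enorm (x - rho y).
Proof.
rewrite /Hlt/= /fst_coord => Hx Hy.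
rewrite ler_wsqrtr// !big_ord_recl; apply: lerD; last first.
  by apply: ler_sum => i _; rewrite !mxE.
by rewrite !mxE eqxx /fst_coord; nra.
Qed.

Lemma measurable_Hlt : measurable H.
Proof.
rewrite (_ : H = (fun y => y ord0 ord0 : measurableTypeR R) @^-1` `]-oo, lambda[).
  by rewrite -[X in measurable X]setTI; apply: measurable_coord.
by apply/seteqP; split => y; rewrite /Hlt/= in_itv.
Qed.

End reflection.

(** * The kernel of the fractional Laplacian *)

Section riesz_kernel.
Context {R : realType} (n : nat) (alpha : R).
Implicit Types x y : 'rV[R]_n.

(* The value on the diagonal is 0, since 0 `^ p = 0 for p != 0 and 0^-1 = 0. *)
Definition riesz_kernel x y : R := (enorm (x - y) `^ (n%:R + alpha))^-1.

Lemma riesz_kernel_ge0 x y : 0 <= riesz_kernel x y.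
Proof. by rewrite invr_ge0 powR_ge0. Qed.

Lemma riesz_kernel_le x y s : 0 < alpha -> 0 < s -> s <= enorm (x - y) ->
  riesz_kernel x y <= (s `^ (n%:R + alpha))^-1.
Proof.
move=> a0 s0 sxy; rewrite lef_pV2 ?posrE ?powR_gt0//; last exact: lt_le_trans sxy.
by rewrite ge0_ler_powR ?nnegrE ?enorm_ge0 ?addr_ge0// ltW.
Qed.

(** The diagonal has to be excluded, as the kernel is 0 there instead of infinite. *)
Lemma riesz_kernel_ge x y s : 0 < alpha -> x != y -> enorm (x - y) <= s ->
  (s `^ (n%:R + alpha))^-1 <= riesz_kernel x y.
Proof.
move=> a0; rewrite -subr_eq0 -enorm_gt0 => xy xys.
rewrite lef_pV2 ?posrE ?powR_gt0//; last exact: lt_le_trans xys.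
by rewrite ge0_ler_powR ?nnegrE ?enorm_ge0 ?addr_ge0 ?(le_trans (enorm_ge0 _) xys)// ltW.
Qed.

Lemma nonlocal_quotE (w : 'rV[R]_n -> R) x y :
  nonlocal_quot alpha w x y = (w x - w y) * riesz_kernel x y.
Proof. by []. Qed.

Lemma measurable_riesz_kernel x :
  measurable_fun [set: 'rV[R]_n] (riesz_kernel x : _ -> measurableTypeR R).
Proof.
rewrite (_ : riesz_kernel x = fun y => enorm (x - y) `^ (- (n%:R + alpha))).
  exact: (measurableT_comp (measurable_powR _) (measurable_enormB x)).
by apply/funext => y; rewrite powRN.
Qed.

Lemma measurable_nonlocal_quot (w : 'rV[R]_n -> R) x :
  measurable_fun [set: 'rV[R]_n] (w : _ -> measurableTypeR R) ->
  measurable_fun [set: 'rV[R]_n] (nonlocal_quot alpha w x : _ -> measurableTypeR R).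
Proof.
move=> mw; apply: measurable_funM; last exact: measurable_riesz_kernel.
exact: measurable_funB.
Qed.

End riesz_kernel.

(** * Folding an integral along the hyperplane *)

Section antisymmetric.
Context {R : realType} (n : nat) (alpha lambda : R).
Context (alpha_gt0 : 0 < alpha).

Local Notation rho := (@reflect_fst R n lambda).
Local Notation H := (@Hlt R n lambda).
Local Notation K := (@riesz_kernel R n.+1 alpha).

Context (mu : {measure set 'rV[R]_n.+1 -> \bar R})
  (mu_rho : forall A, measurable A -> mu (rho @^-1` A) = mu A).

Lemma riesz_kernel_reflect_le x y : H x -> H y -> x != y -> K x (rho y) <= K x y.
Proof.
move=> Hx Hy xy; apply: riesz_kernel_le => //; last exact: enorm_reflect_le.
by rewrite enorm_gt0 subr_eq0.
Qed.

(* Pairing y with its mirror image, the nearer copy y carries the larger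
   kernel, so on the pair the quotient is at most that of the farther copy,
   where w x - w y and w x + w y add up to 2 w x. *)
Lemma Rintegral_nonlocal_quot_antisym (w : 'rV[R]_n.+1 -> R) x (A : set 'rV[R]_n.+1) :
  measurable A ->
  mu.-integrable A (EFin \o nonlocal_quot alpha w x) ->
  mu.-integrable A (EFin \o K x) ->
  H x -> w x <= 0 ->
  (forall y, H y -> w (rho y) = - w y) ->
  (forall y, fst_coord y = lambda -> w y = 0) ->
  (forall y, H y -> A y -> A (rho y)) ->
  (forall y, H y -> A y -> w x <= w y) ->
  (forall y, H y -> A (rho y) -> ~ A y -> w y <= 0) ->
  \int[mu]_(y in A) nonlocal_quot alpha w x y <=
  w x * \int[mu]_(y in A `\` H) K x y.
Proof.
move=> mA intq intK Hx wx0 wrho w0 Arho wxy wy0.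
have mAH : measurable (A `\` H) by apply: measurableD => //; exact: measurable_Hlt.
have intKH : mu.-integrable (A `\` H) (EFin \o K x).
  by apply: integrableS intK => // ? [].
have ihA : mu.-integrable [set: _] (EFin \o (nonlocal_quot alpha w x \_ A)).
  by rewrite -restrict_EFin; apply/(integrable_mkcond _ mA).
have ihAH : mu.-integrable [set: _] (EFin \o ((fun z => w x * K x z) \_ (A `\` H))).
  rewrite -restrict_EFin; apply/(integrable_mkcond _ mAH).
  exact: (integrableZl mAH (w x) intKH).
(* Both integrals are extended by zero to the whole space, so that their difference is a single
   integral, to which symmetrization applies. *)
rewrite -RintegralZl// -subr_le0 (Rintegral_mkcond mu A) (Rintegral_mkcond mu (A `\` H)).
rewrite -RintegralB//.
apply: (Rintegral_symmetrized_le0 (measurable_reflect_fst lambda) mu_rho).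
  exact: (integrableB _ ihA ihAH).
pose h y := (nonlocal_quot alpha w x \_ A) y - ((fun z => w x * K x z) \_ (A `\` H)) y.
have hH y : H y -> h y + h (rho y) <= 0.
  move=> Hy; rewrite /h !patchE.
  have -> : (y \in A `\` H) = false by apply/negbTE/negP; rewrite inE => -[].
  have rhoNH : ~ H (rho y) by move: Hy; rewrite /Hlt/= /fst_coord reflect_fst0; lra.
  have -> : (rho y \in A `\` H) = (rho y \in A).
    by apply/idP/idP; rewrite !inE; [case | split].
  rewrite !nonlocal_quotE wrho// opprK.
  have K0 := riesz_kernel_ge0 alpha x (rho y).
  (* Outside its set a restricted function takes the value [point]. *)
  have pt : point = 0 :> R by [].
  (* When [A] contains the mirror image of [y] but not [y], the sum reduces to [w y * K x (rho y)],
     whose sign is that of [w y]. *)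
  have [Ay|nAy] := pselect (A y); last first.
    rewrite (memNset nAy) pt; have [Ary|nAry] := pselect (A (rho y)).
      rewrite (mem_set Ary); have wy := wy0 y Hy Ary nAy.
      by move: (K x (rho y)) K0 (w x) (w y) wy => k k0 a b b0; nra.
    by rewrite (memNset nAry) subrr addr0.
  rewrite (mem_set Ay) (mem_set (Arho _ Hy Ay)) pt.
  have xy : (w x - w y) * K x y <= (w x - w y) * K x (rho y).
    have [xy|/eqP xy] := pselect (x = y); first last.
      apply: ler_wnM2l; first by rewrite subr_le0 (wxy _ Hy Ay).
      exact: (riesz_kernel_reflect_le Hx Hy xy).
    have -> : w x - w y = 0 by rewrite xy subrr.
    by move: (K x y) (K x (rho y)) => k k'; rewrite !mul0r.
  (* By [xy] the sum is at most [(a - b) * k' + (a + b) * k' - a * k' = a * k'], and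
     [a <= 0 <= k']. *)
  move: (K x y) (K x (rho y)) K0 (w x) wx0 (w y) xy => k k' k0 a a0 b xy.
  by nra.
move=> y; change (h y + h (rho y) <= 0).
have [yl|yl|yl] := ltgtP (fst_coord y) lambda.
- exact: (hH y yl).
- have Hry : H (rho y) by move: yl; rewrite /Hlt/= /fst_coord reflect_fst0; lra.
  by rewrite addrC -{2}(reflect_fstK lambda y); exact: (hH _ Hry).
(* On the hyperplane [y] is its own mirror image and [w y = 0], so the two terms of [h y] cancel. *)
rewrite (reflect_fst_fixed yl) /h !patchE.
have -> : (y \in A `\` H) = (y \in A).
  by apply/idP/idP; rewrite !inE; [case | split => //; rewrite /Hlt/= yl ltxx].
have pt : point = 0 :> R by [].
by case: ifPn => _; rewrite ?pt ?nonlocal_quotE ?(w0 y yl); lra.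
Qed.

End antisymmetric.

(** * Integrability from a dyadic decomposition into shells *)

Section shells.
Context {R : realType} (n : nat).
Implicit Types x y : 'rV[R]_n.

Lemma dyadic_between (t : R) : 1 <= t -> exists k, 2 ^+ k <= t < 2 ^+ k.+1.
Proof.
move=> t1; pose m := Num.trunc t.
have m1 : (0 < m)%N by rewrite truncn_gt0.
have /andP[mt tm] : m%:R <= t < m.+1%:R by apply: truncn_itv; lra.
exists (trunc_log 2 m).
have /andP[h1 h2] := trunc_log_bounds (isT : 1 < 2)%N m1.
rewrite -!natrX; apply/andP; split.
  by apply: le_trans mt; rewrite ler_nat.
by apply: lt_le_trans tm _; rewrite ler_nat.
Qed.

(* f is dominated by the series of the M k times the indicators of the balls of
   radius r k, whose integral is bounded by a geometric series. *)
Lemma integrable_shells (x : 'rV[R]_n) (D : set 'rV[R]_n) (f : 'rV[R]_n -> R)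
    (r M : nat -> R) (C q : R) : measurable D ->
  measurable_fun [set: 'rV[R]_n] (f : _ -> measurableTypeR R) ->
  0 < q < 1 -> (forall k, 0 < r k) -> (forall k, 0 <= M k) ->
  (forall k, M k * (2 * r k) ^+ n <= C * q ^+ k) ->
  (forall y, D y -> exists2 k, ball x (r k) y & `|f y| <= M k) ->
  (lebesgue_rV n).-integrable D (EFin \o f).
Proof.
move=> mD mf /andP[q0 q1] r0 M0 Mq fM.
have mfD : measurable_fun D f by exact: measurable_funTS.
apply/integrableP; split; first exact/measurable_EFinP.
set mu := lebesgue_rV n in r0 *.
have mg k : measurable_fun D (fun y => (M k * \1_(ball x (r k)) y)%:E).
  apply/measurable_EFinP; apply: measurable_funM => //.
  by apply: measurable_funTS; apply/measurable_indicP; exact: measurable_ball_rV.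
have g0 k y : (0 <= (M k * \1_(ball x (r k)) y)%:E)%E by rewrite lee_fin mulr_ge0.
apply: (@le_lt_trans _ _ (\int[mu]_(y in D) \sum_(k <oo) (M k * \1_(ball x (r k)) y)%:E)%E).
  apply: ge0_le_integral => //=.
  - by apply/measurable_EFinP; exact: measurableT_comp.
  - exact: ge0_emeasurable_sum.
  - move=> y /fM[k xk fk].
    apply: (@le_trans _ _ (M k * \1_(ball x (r k)) y)%:E).
      by rewrite indicE mem_set// mulr1 lee_fin.
    (* The partial sum of length [k.+1] is the first one that contains the term of index [k]. *)
    apply: le_trans (nneseries_lim_ge k.+1 _) => //.
    by rewrite big_nat_recr//= leeDr// sume_ge0.
rewrite integral_nneseries//.
have C0 : 0 <= C.
  have := Mq 0%N; rewrite expr0 mulr1; apply: le_trans.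
  by rewrite mulr_ge0// exprn_ge0// mulr_ge0// ltW.
apply: (@le_lt_trans _ _ (\sum_(k <oo) (C * q ^+ k)%:E)%E).
  apply: lee_nneseries => [k _ _|k _]; first exact: integral_ge0.
  apply: (@le_trans _ _ (M k * (2 * r k) ^+ n)%:E); last by rewrite lee_fin.
  under eq_integral do rewrite EFinM.
  rewrite ge0_integralZl//=; last 2 first.
  - apply/measurable_EFinP; apply: measurable_funTS.
    by apply/measurable_indicP; exact: measurable_ball_rV.
  - exact: M0.
  rewrite EFinM lee_wpmul2l// ?lee_fin//.
  rewrite integral_indic//; last exact: measurable_ball_rV.
  rewrite -(lebesgue_rV_ball x (r0 k)); apply: le_measure; rewrite ?inE//.
  - by apply: measurableI => //; exact: measurable_ball_rV.
  - exact: measurable_ball_rV.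
apply: (@le_lt_trans _ _ (C * (1 - q)^-1)%:E); last exact: ltry.
apply: lime_le.
  by apply: is_cvg_nneseries => k _ _; rewrite lee_fin mulr_ge0// exprn_ge0// ltW.
apply: nearW => k; rewrite sumEFin lee_fin.
by apply: geometric_le_lim => //; rewrite ger0_norm ?ltW.
Qed.

End shells.

(** * Integrability of the kernel and of the difference quotient *)

Section integrability.
Context {R : realType} (n : nat) (alpha : R).
Context (alpha_gt0 : 0 < alpha).
Implicit Types (x y : 'rV[R]_n) (w : 'rV[R]_n -> R).

Local Notation K := (@riesz_kernel R n alpha).
Local Notation mu := (lebesgue_rV n).

Lemma powR_exprn (a b : R) k : 0 <= a -> (a ^+ k) `^ b = (a `^ b) ^+ k.
Proof.
move=> a0; rewrite -(powR_mulrn k a0) -(powR_mulrn k (powR_ge0 a b)) -!powRrM.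
by congr (_ `^ _); rewrite mulrC.
Qed.

Lemma powRN_lt1 (a b : R) : 1 < a -> 0 < b -> 0 < a `^ (- b) < 1.
Proof.
move=> a1 b0; have a0 : 0 < a by lra.
rewrite powR_gt0//= powRN invf_lt1 ?powR_gt0//.
have e : 1 `^ b = 1 :> R by rewrite powR1.
by rewrite -[ltLHS]e gt0_ltr_powR// nnegrE ltW.
Qed.

(** At distance between [s = 2 ^+ k * r] and [2 * s] the kernel is at most [s]^ - (n%:R +
    alpha)[, and the enclosing cube has side]4 * s[. The product is]4 ^+ n * s [^ (- alpha)],
    geometric in [k] because [alpha > 0]. *)
Lemma integrable_riesz_kernel_far x (r : R) : 0 < r ->
  mu.-integrable (~` eball x r) (EFin \o K x).
Proof.
move=> r0.
have s0 k : 0 < 2 ^+ k * r by rewrite mulr_gt0// exprn_gt0.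
apply: (@integrable_shells _ _ x _ _ (fun k => 2 ^+ k.+1 * r)
  (fun k => ((2 ^+ k * r) `^ (n%:R + alpha))^-1)
  (4 ^+ n * r `^ (- alpha)) (2 `^ (- alpha))).
- by apply: measurableC; exact: measurable_eball.
- exact: measurable_riesz_kernel.
- by apply: powRN_lt1 => //; lra.
- by move=> k; rewrite mulr_gt0// exprn_gt0.
- by move=> k; rewrite invr_ge0 powR_ge0.
- move=> k.
  have -> : 2 * (2 ^+ k.+1 * r) = 4 * (2 ^+ k * r) by rewrite exprS; lra.
  have r0' : 0 <= r by lra.
  have k0 : 0 <= 2 ^+ k :> R by rewrite exprn_ge0.
  rewrite -powR_exprn; last lra.
  rewrite -mulrA -(powRM _ r0' k0).
  rewrite [r * _]mulrC; move: (2 ^+ k * r) (s0 k) => t t0.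
  rewrite powRD ?(gt_eqF t0) ?implybT// powR_mulrn ?(ltW t0)// exprMn mulrCA.
  rewrite ler_wpM2l ?exprn_ge0// powRN invfM mulrAC mulVf ?mul1r//.
  by rewrite expf_neq0// gt_eqF.
move=> y; rewrite /eball/= => /negP; rewrite -leNgt enormBC => rxy.
have [k /andP[k1 k2]] : exists k, 2 ^+ k <= enorm (x - y) / r < 2 ^+ k.+1.
  by apply: dyadic_between; rewrite ler_pdivlMr// mul1r.
exists k.
  by apply: eball_sub_ball; rewrite /eball/= enormBC -ltr_pdivrMr.
rewrite ger0_norm ?riesz_kernel_ge0//; apply: riesz_kernel_le => //.
by rewrite -ler_pdivlMr.
Qed.

(** A triangle inequality with a dimensional factor, read off coordinate by coordinate. *)
Lemma enorm_far_le x y : enorm y <= n%:R * (enorm x + enorm (x - y)).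
Proof.
apply: enorm_le; first by rewrite addr_ge0 ?enorm_ge0.
move=> i; have -> : y ord0 i = x ord0 i - (x - y) ord0 i by rewrite !mxE; lra.
by apply: le_trans (ler_normB _ _) _; rewrite lerD ?ler_norm_enorm.
Qed.

(** Away from [x] the kernel is at most a constant times the weight that defines [in_Lalpha]. *)
Lemma integrable_mul_kernel_far w x (r : R) : in_Lalpha alpha w -> 0 < r ->
  mu.-integrable (~` eball x r) (EFin \o (fun y => w y * K x y)).
Proof.
move=> [mw wfin] r0; pose p := n%:R + alpha.
have p0 : 0 < p by rewrite /p ltr_wpDl.
pose g y := `|w y| / (1 + enorm y `^ p).
have g0 y : 0 <= g y by rewrite divr_ge0// addr_ge0// powR_ge0.
have mg : measurable_fun [set: 'rV[R]_n] (g : _ -> measurableTypeR R).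
  rewrite (_ : g = fun y => `|w y| * (1 + enorm (0 - y) `^ p) `^ (-1)); last first.
    apply/funext => y; rewrite sub0r enormN /g.
    have d0 : 0 <= 1 + enorm y `^ p by rewrite addr_ge0// powR_ge0.
    by rewrite (powR_inv1 d0).
  apply: measurable_funM; first exact: measurableT_comp.
  apply: (measurableT_comp (measurable_powR _)); apply: measurable_funD => //.
  exact: (measurableT_comp (measurable_powR _) (measurable_enormB 0)).
have ig : mu.-integrable [set: _] (EFin \o g).
  apply/integrableP; split; first exact/measurable_EFinP.
  by under eq_integral do rewrite /= ger0_norm//.
pose B := n%:R * (enorm x / r + 1).
pose C := (r `^ p)^-1 + B `^ p.
have B0 : 0 <= B by rewrite mulr_ge0// addr_ge0// divr_ge0 ?enorm_ge0// ltW.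
have mD : measurable (~` eball x r) by apply: measurableC; exact: measurable_eball.
have igC : mu.-integrable (~` eball x r) (fun y => C%:E * (EFin \o g) y)%E.
  by apply: integrableZl => //; exact: (integrableS _ _ _ ig).
apply: le_integrable igC => //.
  apply/measurable_EFinP; apply: measurable_funTS; apply: measurable_funM => //.
  exact: measurable_riesz_kernel.
move=> y; rewrite /eball/= => /negP; rewrite -leNgt enormBC => rxy.
rewrite lee_fin.
have C0 : 0 <= C by rewrite addr_ge0 ?invr_ge0 ?powR_ge0.
have -> : `|w y * K x y| = `|w y| * K x y.
  by rewrite normrM [X in _ * X]ger0_norm ?riesz_kernel_ge0.
have -> : `|C * g y| = C * g y by rewrite ger0_norm// mulr_ge0.
rewrite /g mulrCA ler_wpM2l// /K -/p.
set t := enorm (x - y) in rxy *.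
have t0 : 0 < t by exact: lt_le_trans rxy.
have den0 : 0 < 1 + enorm y `^ p by rewrite ltr_pwDl// powR_ge0.
have tp0 : 0 < t `^ p by rewrite powR_gt0.
rewrite (ler_pdivlMr _ _ den0) mulrC (ler_pdivrMr _ _ tp0).
have h1 : 1 <= (r `^ p)^-1 * t `^ p.
  rewrite mulrC ler_pdivlMr ?powR_gt0// mul1r ge0_ler_powR ?nnegrE//; lra.
have h2 : enorm y `^ p <= B `^ p * t `^ p.
  rewrite -powRM//; last lra.
  apply: ge0_ler_powR; rewrite ?nnegrE;
    [exact: ltW | exact: enorm_ge0 | by rewrite mulr_ge0// ltW |].
  apply: le_trans (enorm_far_le x y) _; rewrite /B -mulrA ler_wpM2l//.
  rewrite mulrDl mul1r lerD2r// -mulrA ler_peMr ?enorm_ge0//.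
  by rewrite mulrC ler_pdivlMr// mul1r.
by rewrite /C mulrDl; apply: lerD.
Qed.

Lemma integrable_nonlocal_quot_far w x (r : R) : in_Lalpha alpha w -> 0 < r ->
  mu.-integrable (~` eball x r) (EFin \o nonlocal_quot alpha w x).
Proof.
move=> wL r0.
have mD : measurable (~` eball x r) by apply: measurableC; exact: measurable_eball.
rewrite (_ : EFin \o _ = (fun y => (w x)%:E * (EFin \o K x) y) \-
    (EFin \o (fun y => w y * K x y)%R))%E.
  apply: integrableB => //; last exact: integrable_mul_kernel_far.
  by apply: integrableZl => //; exact: integrable_riesz_kernel_far.
by apply/funext => y; rewrite /= nonlocal_quotE mulrBl.
Qed.

(** At distance [t] the quotient is at most [C * t]^ b / t ^+ n[with]b = 1 + theta - alpha > 0[. The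
    volume of a cube of side comparable to]t[cancels]t ^+ n[, which leaves a geometric series of
    ratio]2 [^ (- b)]. *)
Lemma integrable_nonlocal_quot_near w x (r C theta : R) :
  measurable_fun [set: 'rV[R]_n] (w : _ -> measurableTypeR R) ->
  0 < r -> 0 <= C -> alpha < 1 + theta ->
  (forall y, eball x r y -> `|w x - w y| <= C * enorm (x - y) `^ (1 + theta)) ->
  mu.-integrable (eball x r) (EFin \o nonlocal_quot alpha w x).
Proof.
move=> mw r0 C0 ath wC; pose b := 1 + theta - alpha.
have b0 : 0 < b by rewrite /b; lra.
pose s k := r / 2 ^+ k : R.
have s0 k : 0 < s k by rewrite divr_gt0// exprn_gt0.
have M0 k : 0 <= C * s k `^ b * (s k / 2) ^- n.
  by rewrite !mulr_ge0 ?powR_ge0// invr_ge0 exprn_ge0// divr_ge0// ltW.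
(* The shell of index [k] is [s k / 2 <= t <= s k]. It contains its outer sphere, so the open ball
   around it gets the radius [2 * s k]; its side [4 * s k = 8 * (s k / 2)] explains the factor
   [8 ^+ n]. *)
apply: (@integrable_shells _ _ x _ _ (fun k => 2 * s k)
  (fun k => C * s k `^ b * (s k / 2) ^- n) (C * 8 ^+ n * r `^ b) (2 `^ (- b))) => //.
- exact: measurable_eball.
- exact: measurable_nonlocal_quot.
- by apply: powRN_lt1 => //; lra.
- by move=> k; rewrite mulr_gt0.
- move=> k.
  have -> : 2 * (2 * s k) = 8 * (s k / 2) by lra.
  rewrite [(8 * _) ^+ n]exprMn [8 ^+ n * _]mulrC mulrA mulfVK; last first.
    by rewrite expf_neq0// gt_eqF// divr_gt0.
  rewrite /s powRM ?invr_ge0 ?exprn_ge0//; last lra.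
  rewrite -powR_inv1 ?exprn_ge0// -powRrM mulN1r powR_exprn//.
  by rewrite le_eqVlt; apply/orP; left; apply/eqP; ring.
move=> y; rewrite /eball/= enormBC => xyr.
have [->|xy] := pselect (y = x).
  exists 0%N; first (apply/ball_rVP => [|i]; first by rewrite mulr_gt0).
    by rewrite subrr normr0 mulr_gt0.
  by rewrite nonlocal_quotE subrr mul0r normr0.
set t := enorm (x - y) in xyr *.
have t0 : 0 < t by rewrite enorm_gt0 subr_eq0; apply/eqP => /esym.
have [k /andP[k1 k2]] : exists k, 2 ^+ k <= r / t < 2 ^+ k.+1.
  by apply: dyadic_between; rewrite ler_pdivlMr// mul1r ltW.
have tk : t <= s k by rewrite /s ler_pdivlMr ?exprn_gt0// mulrC -ler_pdivlMr.
have kt : s k / 2 <= t.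
  rewrite /s -mulrA -invfM ler_pdivrMr ?mulr_gt0 ?exprn_gt0//.
  by rewrite mulrC -ler_pdivrMr// -exprSr ltW.
exists k.
  apply: eball_sub_ball; rewrite /eball/= enormBC -/t; have := s0 k; lra.
rewrite nonlocal_quotE normrM [X in _ * X]ger0_norm ?riesz_kernel_ge0//.
apply: (@le_trans _ _ (C * t `^ (1 + theta) * K x y)).
  by rewrite ler_wpM2r ?riesz_kernel_ge0// wC// /eball/= enormBC.
rewrite /riesz_kernel -/t -!mulrA ler_wpM2l//.
have -> : t `^ (1 + theta) / t `^ (n%:R + alpha) = t `^ b * t ^- n.
  rewrite -powRN -(powR_mulrn n (ltW t0)) -powRN -!powRD ?(gt_eqF t0) ?implybT//.
  by congr (_ `^ _); rewrite /b; lra.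
apply: ler_pM; rewrite ?powR_ge0 ?invr_ge0 ?exprn_ge0 ?(ltW t0)//.
  by apply: ge0_ler_powR; rewrite ?nnegrE ?(ltW t0) ?(ltW b0) ?(ltW (s0 k)).
have sk0 : 0 < s k / 2 by rewrite divr_gt0.
have -> : r * (2 ^- k / 2) = s k / 2 by rewrite /s mulrA.
rewrite lef_pV2 ?posrE ?exprn_gt0//.
by rewrite lerXn2r ?nnegrE ?(ltW t0) ?(ltW sk0).
Qed.

End integrability.

(** * First-order estimates at a critical point *)

Section first_order.
Context {R : realType} (n : nat).
Implicit Types (x y v z : 'rV[R]_n) (w : 'rV[R]_n -> R).

Lemma is_derive_line w x v (t : R) : differentiable w (x + t *: v) ->
  is_derive t 1 (fun s : R => w (x + s *: v)) ('D_v w (x + t *: v)).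
Proof.
move=> dw.
have e : (fun h : R => h^-1 *: (((fun s : R => w (x + s *: v)) \o shift t) (h *: (1:R)) -
    w (x + t *: v))) =
    (fun h : R => h^-1 *: ((w \o shift (x + t *: v)) (h *: v) - w (x + t *: v))).
  apply/funext => h /=; rewrite /= [h *: (1 : R)]mulr1 scalerDl.
  by rewrite addrCA.
apply: DeriveDef; last by rewrite /derive e.
by rewrite /derivable e; exact: diff_derivable.
Qed.

Lemma derive_gradient w z v : differentiable w z ->
  'D_v w z = \sum_i v ord0 i * gradient w z ord0 i.
Proof.
move=> dw; rewrite deriveE// {1}(row_sum_delta v) linear_sum.
by apply: eq_bigr => i _; rewrite linearZ /= mxE deriveE.
Qed.

(** A weak form of Cauchy-Schwarz: each coordinate is at most the Euclidean norm. *)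
Lemma normr_derive_le w z v : differentiable w z ->
  `|'D_v w z| <= n%:R * (enorm v * enorm (gradient w z)).
Proof.
move=> dw; rewrite derive_gradient//; apply: le_trans (ler_norm_sum _ _ _) _.
have -> : n%:R * (enorm v * enorm (gradient w z)) =
    \sum_(i < n) enorm v * enorm (gradient w z).
  by rewrite sumr_const card_ord mulr_natl.
apply: ler_sum => i _.
by rewrite normrM ler_pM ?ler_norm_enorm.
Qed.

(** Along each coordinate direction, the restriction of [w] to a line through [x] has an interior
    minimum at parameter 0. *)
Lemma gradient_argmin w x (r : R) : 0 < r -> (forall y, differentiable w y) ->
  (forall y, ball x r y -> w x <= w y) -> gradient w x = 0.
Proof.
move=> r0 dw xmin; apply/rowP => i; rewrite !mxE.
have xe : x + 0 *: 'e_i = x :> 'rV[R]_n by rewrite scale0r addr0.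
have dl (t : R) := @is_derive_line w x 'e_i t (dw _).
have [_ d0] : is_derive (0 : R) 1 (fun s : R => w (x + s *: 'e_i)) 0.
  apply: (@derive1_at_min _ _ (- r) r).
  - lra.
  - by move=> t _; have [] := dl t.
  - by rewrite in_itv/=; apply/andP; split; lra.
  - move=> t; rewrite in_itv/= xe -ltr_norml => tr; apply: xmin.
    apply/ball_rVP => // j; rewrite !mxE opprD addrA subrr sub0r normrN.
    apply: le_lt_trans tr; rewrite normrM; apply: ler_piMr => //.
    by case: (_ && _); rewrite ?normr0 ?normr1.
by have [_] := dl 0; rewrite d0 xe.
Qed.

(** By the mean value theorem [w y - w x] is a derivative at a point of the segment. The gradient
    there differs from [gradient w x = 0] by a Holder term, which adds the exponent [theta] to the
    factor [enorm (x - y)]. *)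
Lemma holder_first_order w x (r theta : R) : 0 < theta -> 0 < r ->
  in_C1theta_loc theta w -> gradient w x = 0 ->
  exists2 C, 0 <= C & forall y, eball x r y ->
    `|w x - w y| <= C * enorm (x - y) `^ (1 + theta).
Proof.
move=> theta0 r0 [dw _ wK] gx0.
(* This closed cube is a compact set containing every segment from [x] to a point of the Euclidean
   ball; it provides the Holder constant. *)
pose B := [set y : 'rV[R]_n | forall i, `|x ord0 i - y ord0 i| <= r].
have cB : compact B.
  apply: bounded_closed_compact.
    exists (`|x| + 2 * r); split; first exact: num_real.
    move=> M rM y By; apply: le_trans (ltW rM).
    have : ball x (2 * r) y.
      apply/ball_rVP => [|i]; first by rewrite mulr_gt0.
      by apply: le_lt_trans (By i) _; lra.
    rewrite mx_norm_ball /ball_/= => xy.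
    have -> : y = x - (x - y) by rewrite opprB addrCA subrr addr0.
    by apply: le_trans (ler_normB _ _) _; rewrite lerD2l ltW.
  rewrite (_ : B = \bigcap_(i in [set: 'I_n])
      ((fun y : 'rV[R]_n => y ord0 i) @^-1` `[x ord0 i - r, x ord0 i + r])).
    apply: closed_bigI => i _; apply: preimage_closed; last exact: interval_closed.
    by move=> y _; exact: coord_continuous.
  apply/seteqP; split => y H i.
    by move=> _ /=; have := H i; rewrite in_itv/= ler_norml; lra.
  by have := H i Logic.I; rewrite /= in_itv/= ler_norml; lra.
have [M HM] := wK B cB.
exists (n%:R * `|M|); first by rewrite mulr_ge0.
move=> y; rewrite /eball/= => yx.
pose v := y - x.
have v1 : x + 1 *: v = y by rewrite scale1r /v addrCA subrr addr0.
have v0 : x + 0 *: v = x by rewrite scale0r addr0.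
have Bv s : 0 <= s <= 1 -> B (x + s *: v).
  move=> /andP[s0 s1] i; rewrite !mxE opprD addrA subrr sub0r normrN normrM.
  rewrite ger0_norm//; apply: le_trans (ltW yx).
  have := ler_norm_enorm v i; rewrite !mxE; apply: le_trans.
  by rewrite ler_piMl.
have [s] := @MVT R (fun s => w (x + s *: v)) (fun s => 'D_v w (x + s *: v)) 0 1
  ltr01 (fun s _ => @is_derive_line w x v s (dw _)) (derivable_within_continuous
   (fun s _ => ex_derive (is_derive := @is_derive_line w x v s (dw _)))).
rewrite in_itv/= v1 v0 subr0 mulr1 => /andP[s0 s1] e.
rewrite distrC e; apply: le_trans (normr_derive_le v (dw _)) _.
rewrite -!mulrA ler_wpM2l// [enorm (x - y)]enormBC -/v.
have /HM := Bv 0 ltac:(by rewrite lexx ler01); rewrite v0.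
move=> /(_ (x + s *: v)) H; have {}H := H (Bv s ltac:(by rewrite !ltW)).
move: H; rewrite gx0 sub0r enormN => gH.
have vn0 := enorm_ge0 v.
have [ve|ve] := eqVneq (enorm v) 0.
  by rewrite ve mul0r mulr_ge0// powR_ge0.
clearbody v.
have tp : enorm v `^ (1 + theta) = enorm v * enorm v `^ theta.
  by rewrite powRD ?ve ?implybT// powRr1.
suff gv : enorm (gradient w (x + s *: v)) <= `|M| * enorm v `^ theta.
  rewrite tp; move: (enorm v) vn0 (enorm _) (_ `^ _) gv => a a0 b d bd.
  by rewrite mulrCA; exact: ler_wpM2l.
apply: le_trans gH _.
apply: (@le_trans _ _ (`|M| * enorm (x - (x + s *: v)) `^ theta)).
  by apply: ler_wpM2r; [exact: powR_ge0 | exact: ler_norm].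
apply: ler_wpM2l; first exact: normr_ge0.
rewrite opprD addrA subrr sub0r enormN enormZ (ger0_norm (ltW s0)).
apply: ge0_ler_powR; rewrite ?nnegrE; [exact: ltW| |exact: vn0|].
  by apply: mulr_ge0 => //; exact: ltW.
by apply: ler_piMl => //; exact: ltW.
Qed.

End first_order.

(** * Lower bound for kernel integrals *)

Section kernel_lower_bound.
Context {R : realType} (n : nat) (alpha : R).
Context (alpha_gt0 : 0 < alpha).
Local Notation mu := (lebesgue_rV n).

(** The cube around [z] contributes its volume times a lower bound of the kernel at distance at most
    [s]. *)
Lemma Rintegral_riesz_kernel_ge (x z : 'rV[R]_n) (D : set 'rV[R]_n) (r s : R) :
  measurable D -> mu.-integrable D (EFin \o riesz_kernel alpha x) ->
  0 < r -> ball z r `<=` D ->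
  (forall y, ball z r y -> x != y /\ enorm (x - y) <= s) ->
  (2 * r) ^+ n / s `^ (n%:R + alpha) <= \int[mu]_(y in D) riesz_kernel alpha x y.
Proof.
move=> mD iK r0 zD zs; rewrite -lee_fin.
rewrite fineK; last exact: integrable_fin_num.
have mK := measurable_riesz_kernel alpha x.
have mB := measurable_ball_rV z r.
apply: (@le_trans _ _ (\int[mu]_(y in ball z r) (riesz_kernel alpha x y)%:E)%E); last first.
  apply: ge0_subset_integral => //.
    by apply/measurable_EFinP; exact: measurable_funTS.
  by move=> y _; rewrite lee_fin riesz_kernel_ge0.
rewrite mulrC EFinM -(lebesgue_rV_ball z r0) -integral_cst//.
apply: ge0_le_integral => //.
- by move=> y _; rewrite lee_fin invr_ge0 powR_ge0.
- by apply/measurable_EFinP; exact: measurable_funTS.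
- by move=> y /zs[xy ys]; rewrite lee_fin; exact: riesz_kernel_ge.
Qed.

End kernel_lower_bound.

(** * Antisymmetric functions and the fractional Laplacian at a negative minimum *)

Section antisymmetric_function.
Context {R : realType} (n : nat) (alpha lambda : R) (w : 'rV[R]_n.+1 -> R).
Context (alpha_gt0 : 0 < alpha).
Context (w_rho : forall x, @Hlt R n lambda x -> w (reflect_fst lambda x) = - w x).

Local Notation rho := (@reflect_fst R n lambda).
Local Notation H := (@Hlt R n lambda).
Local Notation mu := (lebesgue_rV n.+1).

(** Antisymmetry is assumed on the open half space only, so continuity has to carry it to the
    hyperplane. If [w y] were nonzero, two mirror points close to [y] would both have its sign, yet
    their values are opposite. *)
Lemma antisym_hyperplane0 y : {for y, continuous w} -> fst_coord y = lambda -> w y = 0.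
Proof.
move=> cw yl; apply/eqP/negP => /negP wy0.
have /cvgrPdist_lt/(_ `|w y|) := cw; rewrite normr_gt0 => /(_ wy0).
move=> /nbhs_ballP[r /= r0 rw].
pose p (s : R) : 'rV[R]_n.+1 := y + s *: 'e_ord0.
have p0 s : p s ord0 ord0 = lambda + s.
  by rewrite !mxE !eqxx mulr1 -yl.
have pS s i : p s ord0 (lift ord0 i) = y ord0 (lift ord0 i).
  by rewrite !mxE /= mulr0 addr0.
have bp s : `|s| < r -> ball y r (p s).
  move=> sr; apply/ball_rVP => // i; have [j ->|->] := unliftP ord0 i.
    by rewrite pS subrr normr0.
  by rewrite p0 -[y _ _]/(fst_coord y) yl opprD addrA subrr sub0r normrN.
have rp : rho (p (- (r / 2))) = p (r / 2).
  apply/rowP => i; have [j ->|->] := unliftP ord0 i.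
    by rewrite reflect_fstS !pS.
  by rewrite reflect_fst0 !p0; lra.
have Hp : H (p (- (r / 2))) by rewrite /Hlt/= /fst_coord p0; lra.
have h1 := rw _ (bp (- (r / 2)) ltac:(by rewrite normrN gtr0_norm; lra)).
have h2 := rw _ (bp (r / 2) ltac:(by rewrite gtr0_norm; lra)).
move: h1 h2; rewrite /= -rp (w_rho Hp).
move: (w _) (w y) wy0 => a b b0.
by have [b1|b1] := leP 0 b; rewrite ?(ger0_norm b1) ?(ltr0_norm b1) !ltr_norml; lra.
Qed.

Lemma ball_sub_Hlt x : ball x (lambda - fst_coord x) `<=` H.
Proof.
move=> y; have [xl|xl] := leP (lambda - fst_coord x) 0.
  by move=> [+ _]; rewrite ltNge xl.
by move=> /(ball_rVP _ _ xl)/(_ ord0); rewrite /Hlt/= /fst_coord ltr_norml; lra.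
Qed.

(* Near the minimum point x the quotient is nonpositive, so the truncated
   integrals decrease with the radius; they are bounded below because the
   gradient vanishes at x, which makes the quotient integrable. *)
Lemma frac_laplacian_argmin_le (c theta : R) x : 0 < c ->
  Num.max 0 (alpha - 1) < theta ->
  in_Lalpha alpha w -> in_C1theta_loc theta w ->
  H x -> w x < 0 -> (forall y, H y -> w x <= w y) ->
  frac_laplacian c alpha w x <= c * (w x * \int[mu]_(y in ~` H) riesz_kernel alpha x y).
Proof.
move=> c0; rewrite gt_max => /andP[theta0 atheta] wL wC Hx wx0 xmin.
have [dw _ _] := wC.
have cw y : {for y, continuous w} by exact: differentiable_continuous.
have w0 y : fst_coord y = lambda -> w y = 0 by exact: antisym_hyperplane0.
have [mw _] := wL.
have mu_rho A : measurable A -> mu (rho @^-1` A) = mu A by exact: lebesgue_rV_reflect.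
pose delta := lambda - fst_coord x.
have delta0 : 0 < delta by move: Hx; rewrite /Hlt/= /delta; lra.
(* Negativity of [w] near [x] gives the sign that folding asks for at a point of the removed ball
   whose mirror image is kept. *)
have [d [d0 dd dneg]] : exists d, [/\ 0 < d, d <= delta & forall y, ball x d y -> w y < 0].
  have : nbhs x [set y | w y < 0].
    by have /cvgr_lt/(_ 0 wx0) := cw x.
  move=> /nbhs_ballP[r /= r0 rw]; exists (Num.min r delta); split.
  - by rewrite lt_min r0.
  - by rewrite ge_min lexx orbT.
  - have rd : Num.min r delta <= r by rewrite ge_min lexx.
    by move=> y /(le_ball rd) /rw.
have dH y : ball x d y -> H y by move=> /(le_ball dd)/ball_sub_Hlt.
pose q := nonlocal_quot alpha w x.
have qle0 y : ball x d y -> q y <= 0.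
  move=> /dH/xmin xy; rewrite /q nonlocal_quotE; apply: mulr_le0_ge0.
    by rewrite subr_le0.
  exact: riesz_kernel_ge0.
have mE e : measurable (eball x e) by exact: measurable_eball.
have mCE e : measurable (~` eball x e) by exact: measurableC.
have iqn : mu.-integrable (eball x d) (EFin \o q).
  have gx : gradient w x = 0.
    by apply: (gradient_argmin d0) => // y /dH /xmin.
  have [C C0 hC] := holder_first_order theta0 d0 wC gx.
  have ath : alpha < 1 + theta by lra.
  exact: (integrable_nonlocal_quot_near mw d0 C0 ath hC).
have iqf e : 0 < e -> mu.-integrable (~` eball x e) (EFin \o q).
  by move=> e0; exact: integrable_nonlocal_quot_far.
have iq : mu.-integrable [set: _] (EFin \o q).
  rewrite -(setvU (eball x d)); apply/integrableP; split.
    by apply: measurable_funTS; apply/measurable_EFinP; exact: measurable_nonlocal_quot.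
  rewrite ge0_integral_setU//=.
  - apply: lte_add_pinfty.
      by have /integrableP[] := iqf d d0.
    by have /integrableP[] := iqn.
  - apply: measurable_funTS; apply/measurable_EFinP; apply: measurableT_comp => //.
    exact: measurable_nonlocal_quot.
  - by apply/disj_setPS => y [].
pose I e := \int[mu]_(y in ~` eball x e) q y.
have IU e : I e + \int[mu]_(y in eball x e) q y = \int[mu]_y q y.
  rewrite -[in RHS](setvU (eball x e)) Rintegral_setU//.
    by rewrite setvU.
  by apply/disj_setPS => y [].
have le_eball e y : eball x e y -> e <= d -> ball x d y.
  by move=> xy ed; apply: eball_sub_ball; exact: lt_le_trans ed.
have Ige e : e <= d -> \int[mu]_y q y <= I e.
  move=> ed; rewrite -(IU e) gerDl.
  apply: Rintegral_le0 => // [|y /le_eball/(_ ed)/qle0//].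
  exact: integrableS iq.
have Ile e : 0 < e < d -> I e <= w x * \int[mu]_(y in ~` H) riesz_kernel alpha x y.
  move=> /andP[e0 ed].
  have eH y : eball x e y -> H y by move=> /le_eball/(_ (ltW ed))/dH.
  have -> : ~` H = ~` eball x e `\` H.
    by apply/seteqP; split => y; [move=> nHy; split => // /eH | case].
  apply: (Rintegral_nonlocal_quot_antisym alpha_gt0 mu_rho (mCE e) (iqf e e0)
    (integrable_riesz_kernel_far alpha_gt0 x e0) Hx (ltW wx0) w_rho w0).
  - move=> y Hy _ /eH; move: Hy; rewrite /Hlt/= /fst_coord reflect_fst0; lra.
  - by move=> y Hy _; exact: xmin.
  - by move=> y Hy _ /contrapT/le_eball/(_ (ltW ed))/dneg/ltW.
have Imono e1 e2 : e1 <= e2 -> e2 <= d -> I e1 <= I e2.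
  move=> e12 e2d; rewrite -(lerD2r (\int[mu]_(y in eball x e2) q y)) IU -(IU e1) lerD2l.
  have -> : eball x e2 = eball x e1 `|` (eball x e2 `\` eball x e1).
    apply/seteqP; split => y; last by case=> [|[]//]; move=> /lt_le_trans; exact.
    by move=> y2; have [y1|y1] := pselect (eball x e1 y); [left | right].
  rewrite Rintegral_setU//.
  - rewrite gerDl; apply: Rintegral_le0; first exact: measurableD.
      by apply: integrableS iq => //; exact: measurableD.
    by move=> y [/le_eball/(_ e2d)/qle0].
  - exact: measurableD.
  - by apply: integrableS iq => //; apply: measurableU => //; exact: measurableD.
  - by apply/disj_setPS => y [? []].
(* As [lim] is total, convergence has to be established before the bound passes to the limit: [I] is
   nondecreasing near 0 and bounded below by the full integral. *)
rewrite /frac_laplacian ler_pM2l//; apply: limr_le.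
  apply: nondecreasing_at_right_is_cvgr.
    near=> e => e1 e2; rewrite !in_itv/= => /andP[_ e1e] /andP[_ e2e] e12.
    apply: Imono => //; apply: (le_trans (ltW e2e)); near: e.
    by apply: nbhs_right_le.
  near=> e; exists (\int[mu]_y q y) => _ [e1 /= + <-]; rewrite in_itv/= => /andP[_ e1e].
  apply: Ige; apply: (le_trans (ltW e1e)); near: e.
  by apply: nbhs_right_le.
near=> e; apply: Ile; apply/andP; split; near: e; first exact: nbhs_right_gt.
exact: nbhs_right_lt.
Unshelve. all: by end_near.
Qed.

End antisymmetric_function.

(** * The nonlocal normal derivative below the half space *)

Section upper_half_space.
Context {R : realType} (n : nat) (alpha lambda : R) (w : 'rV[R]_n.+2 -> R).
Context (alpha_gt0 : 0 < alpha).
Context (w_rho : forall x, @Hlt R n.+1 lambda x -> w (reflect_fst lambda x) = - w x).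

Local Notation rho := (@reflect_fst R n.+1 lambda).
Local Notation H := (@Hlt R n.+1 lambda).
Local Notation mu := (lebesgue_rV n.+2).
Local Notation U := (@upper_half R n.+1).

Lemma upper_half_reflect y : U y -> U (rho y).
Proof. by rewrite /upper_half/= /lst_coord mxE. Qed.

Lemma measurable_upper_half : measurable U.
Proof.
rewrite (_ : U = (fun y : 'rV[R]_n.+2 => y ord0 ord_max : measurableTypeR R) @^-1` `]0, +oo[).
  by rewrite -[X in measurable X]setTI; apply: measurable_coord.
by apply/seteqP; split => y; rewrite /upper_half/= in_itv/= andbT.
Qed.

(** If [w x < m <= 0], then [w x] lies below all values of [w] on the part of [U] in [H]. Folding
    over [U] bounds the integral by [w x] times the positive kernel mass of [U] outside [H], so it
    would be negative. *)
Lemma nonlocal_normal_ge0_lower_bound (c m : R) x : 0 < c -> in_Lalpha alpha w ->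
  (forall y, fst_coord y = lambda -> w y = 0) ->
  H x -> lst_coord x < 0 -> m <= 0 -> (forall y, H y -> U y -> m <= w y) ->
  0 <= nonlocal_normal c alpha w x -> m <= w x.
Proof.
move=> c0 wL w0 Hx xn m0 wm; rewrite /nonlocal_normal pmulr_rge0// => I0.
rewrite leNgt; apply/negP => wxm.
have mU := measurable_upper_half.
(* The last coordinate alone keeps [U] away from [x], so no singularity is met. *)
have Ufar : U `<=` ~` eball x (- lst_coord x).
  move=> y; rewrite /upper_half/eball/= => yn /(le_lt_trans (ler_norm_enorm _ ord_max)).
  by rewrite !mxE -/(lst_coord y) -/(lst_coord x) ltr_norml; lra.
have r0 : 0 < - lst_coord x by lra.
have mC : measurable (~` eball x (- lst_coord x)).
  by apply: measurableC; exact: measurable_eball.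
have iK : mu.-integrable U (EFin \o riesz_kernel alpha x).
  by apply: integrableS Ufar _ => //; exact: integrable_riesz_kernel_far.
have iq : mu.-integrable U (EFin \o nonlocal_quot alpha w x).
  by apply: integrableS Ufar _ => //; exact: integrable_nonlocal_quot_far.
have mUH : measurable (U `\` H) by apply: measurableD => //; exact: measurable_Hlt.
have Ile : \int[mu]_(y in U) nonlocal_quot alpha w x y <=
    w x * \int[mu]_(y in U `\` H) riesz_kernel alpha x y.
  have mu_rho A : measurable A -> mu (rho @^-1` A) = mu A.
    exact: lebesgue_rV_reflect.
  have wx0 : w x <= 0 by lra.
  apply: (Rintegral_nonlocal_quot_antisym alpha_gt0 mu_rho mU iq iK Hx wx0 w_rho w0).
  - by move=> y _; exact: upper_half_reflect.
  - by move=> y Hy Uy; apply: le_trans (wm y Hy Uy); exact: ltW.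
  - by move=> y _ /upper_half_reflect; rewrite reflect_fstK.
(* Centre of a unit cube inside [U] and outside [H]; only positivity of the mass matters here. *)
pose z : 'rV[R]_n.+2 := \row_i (if i == ord0 then lambda + 1 else 1).
have half0 : 0 < 2^-1 :> R by [].
have zP y : ball z (2^-1) y -> [/\ (U `\` H) y, x != y &
    enorm (x - y) <= n.+2%:R * (enorm (x - z) + 2^-1)].
  move=> /(ball_rVP _ _ half0) zy.
  have y0 : lambda < fst_coord y.
    by have := zy ord0; rewrite !mxE eqxx ltr_norml /fst_coord; lra.
  have yn : 0 < lst_coord y.
    by have := zy ord_max; rewrite !mxE ltr_norml /lst_coord /=; lra.
  split.
  - by split => //; rewrite /Hlt/=; lra.
  - by apply/eqP => xy; move: Hx; rewrite xy /Hlt/=; lra.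
  - apply: enorm_le; first by rewrite addr_ge0 ?enorm_ge0// invr_ge0.
    move=> i; have -> : (x - y) ord0 i = (x - z) ord0 i + (z ord0 i - y ord0 i).
      by rewrite !mxE; lra.
    apply: le_trans (ler_normD _ _) _; apply: lerD; first exact: ler_norm_enorm.
    exact: ltW.
have iKH : mu.-integrable (U `\` H) (EFin \o riesz_kernel alpha x).
  by apply: integrableS iK => // y [].
have J_ge := Rintegral_riesz_kernel_ge alpha_gt0 mUH iKH half0
  (fun y zy => let: And3 UHy _ _ := zP y zy in UHy)
  (fun y zy => let: And3 _ xy xyS := zP y zy in conj xy xyS).
have : 0 < \int[mu]_(y in U `\` H) riesz_kernel alpha x y.
  apply: lt_le_trans J_ge; rewrite divr_gt0//.
  by apply: powR_gt0; rewrite mulr_gt0// ltr_pwDr ?enorm_ge0.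
by move: Ile I0 => + + J0; nra.
Qed.

End upper_half_space.

(** * Growth of the exterior kernel mass near the hyperplane and choice of the width *)

Lemma exterior_kernel_ge (R : realType) (n : nat) (alpha lambda : R) (x : 'rV[R]_n.+1) :
  0 < alpha -> Hlt lambda x ->
  ((2 * n.+1%:R) `^ (n.+1%:R + alpha))^-1 * (lambda - fst_coord x) `^ (- alpha) <=
  \int[lebesgue_rV n.+1]_(y in ~` @Hlt R n lambda) riesz_kernel alpha x y.
Proof.
move=> alpha0; rewrite /Hlt/= => Hx.
pose d := lambda - fst_coord x.
have d0 : 0 < d by rewrite /d; lra.
pose z : 'rV[R]_n.+1 := \row_i (if i == ord0 then lambda + d / 2 else x ord0 i).
have zP y : ball z (d / 2) y -> [/\ (~` @Hlt R n lambda) y, x != y &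
    enorm (x - y) <= n.+1%:R * (2 * d)].
  have d20 : 0 < d / 2 by lra.
  move=> /(ball_rVP _ _ d20) zy.
  have y0 : lambda < fst_coord y < lambda + d.
    by have := zy ord0; rewrite !mxE eqxx ltr_norml /fst_coord; lra.
  split.
  - by rewrite /Hlt/=; lra.
  - by apply/eqP => xy; move: Hx; rewrite xy; lra.
  - apply: enorm_le; first lra.
    move=> i; have [j ->|->] := unliftP ord0 i.
      by have := zy (lift ord0 j); rewrite !mxE /=; lra.
    by move: y0; rewrite !mxE ler_norml /fst_coord /d /fst_coord; lra.
have mH : measurable (~` @Hlt R n lambda) by apply: measurableC; exact: measurable_Hlt.
have iK : (lebesgue_rV n.+1).-integrable (~` @Hlt R n lambda) (EFin \o riesz_kernel alpha x).
  apply: (@integrableS _ _ _ _ (~` eball x d)) => //.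
  - by apply: measurableC; exact: measurable_eball.
  - by apply: subsetC => y /eball_sub_ball; exact: ball_sub_Hlt.
  - exact: integrable_riesz_kernel_far.
apply: le_trans (Rintegral_riesz_kernel_ge (s := n.+1%:R * (2 * d)) alpha0 mH iK
  (ltac:(lra) : 0 < d / 2) _ _); last 2 first.
- by move=> y /zP[].
- by move=> y /zP[].
rewrite -/d (_ : 2 * (d / 2) = d); last lra.
have n2 : 0 <= 2 * n.+1%:R :> R by rewrite mulr_ge0.
have -> : n.+1%:R * (2 * d) = 2 * n.+1%:R * d by ring.
rewrite (@powRM R _ _ (n.+1%:R + alpha) n2 (ltW d0)).
rewrite (@powRD R d n.+1%:R alpha) ?(gt_eqF d0) ?implybT// (powR_mulrn n.+1 (ltW d0)).
rewrite powRN !invfM.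
by rewrite [leRHS]mulrCA [d ^+ _ * _]mulrA mulfV ?mul1r// expf_neq0// gt_eqF.
Qed.

(** Below [b]^ a^-1[one has]d [^ a < b = kappa / (]|m| + 1)[, hence]kappa * d [^ (- a)] exceeds
    [|m| + 1], and so [- m]. The added 1 keeps the denominator positive when [m = 0]. *)
Lemma small_powR_dominates (R : realType) (a kappa m : R) : 0 < a -> 0 < kappa ->
  exists2 l : R, 0 < l & forall d, 0 < d < l -> 0 < kappa * d `^ (- a) + m.
Proof.
move=> a0 k0; pose b := kappa / (`|m| + 1).
have m1 : 0 < `|m| + 1 by rewrite ltr_wpDl.
have b0 : 0 < b by rewrite divr_gt0.
exists (b `^ a^-1); first exact: powR_gt0.
move=> d /andP[d0 db].
have : d `^ a < b.
  rewrite -[ltRHS](powRr1 (ltW b0)) -(mulVf (lt0r_neq0 a0)) powRrM.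
  by rewrite gt0_ltr_powR// nnegrE ?powR_ge0// ltW.
rewrite /b ltr_pdivlMr// mulrC -ltr_pdivlMr ?powR_gt0// -powRN.
by have := ler_norm (- m); rewrite normrN; lra.
Qed.

(** The width [l0] comes before the sets and the functions, so it is uniform in them once the lower
    bound [m] of [a] is fixed. The dimension [n.+2] keeps the first and the last coordinate
    distinct. *)
Theorem lemma2 (R : realType) (n : nat) (c alpha lambda m : R)
    (c_gt0 : 0 < c) (alpha_gt0 : 0 < alpha) (alpha_lt2 : alpha < 2) :
  exists2 l0 : R, 0 < l0 &
  forall l : R, 0 < l < l0 ->
  forall (Omega1 Omega2 : set 'rV[R]_n.+2) (theta : R)
         (w a : 'rV[R]_n.+2 -> R),
    bounded_set Omega1 ->
    Omega1 `<=` [set x | 0 <= lst_coord x /\ lambda - l < fst_coord x < lambda] ->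
    Omega2 `<=` [set x | Hlt lambda x /\ lst_coord x < 0] ->
    Num.max 0 (alpha - 1) < theta ->
    in_Lalpha alpha w ->
    in_C1theta_loc theta w ->
    (forall x, Omega1 x -> m <= a x) ->
    (forall x, Omega1 x -> 0 <= frac_laplacian c alpha w x + a x * w x) ->
    (forall x, Omega2 x -> 0 <= nonlocal_normal c alpha w x) ->
    (forall x, (Hlt lambda `\` (Omega1 `|` Omega2)) x -> 0 <= w x) ->
    (forall x, Hlt lambda x -> w (reflect_fst lambda x) = - w x) ->
    forall x, Omega1 x -> 0 <= w x.
Proof.
(* This is [c] times the constant of [exterior_kernel_ge] in dimension [n.+2]. *)
have kappa_gt0 : 0 < c * ((2 * n.+2%:R) `^ (n.+2%:R + alpha))^-1.
  by rewrite mulr_gt0// invr_gt0 powR_gt0.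
have [l0 l00 l0P] := small_powR_dominates m alpha_gt0 kappa_gt0.
exists l0 => // l /andP[l_gt0 ll0] Omega1 Omega2 theta w a bO1 O1 O2 htheta wL wC am
  lapl normal wge0 wanti x Ox; rewrite leNgt; apply/negP => wx0.
have [dw _ _] := wC.
have cw y : {for y, continuous w} by exact: differentiable_continuous.
have w0 y : fst_coord y = lambda -> w y = 0.
  by move=> yl; exact: (antisym_hyperplane0 wanti (cw y) yl).
have clO1 (B : set 'rV[R]_n.+2) : closed B -> Omega1 `<=` B -> closure Omega1 `<=` B.
  by move=> /closure_id {2}-> /closure_subset.
have [x0 [clx0 x0min]] : exists x0, closure Omega1 x0 /\
    forall y, closure Omega1 y -> w x0 <= w y.
  have [|||x0 + x0min] := @EVT_min_rV R n.+2 w (closure Omega1).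
  - by exists x; exact: subset_closure.
  - apply: bounded_closed_compact; last exact: closed_closure.
    have [M [_ MO1]] := bO1.
    have cB : closed [set y : 'rV[R]_n.+2 | `|y| <= M + 1].
      rewrite (_ : mkset _ = (fun y : 'rV[R]_n.+2 => `|y|) @^-1` [set t : R | t <= M + 1])//.
      apply: preimage_closed; last exact: closed_le.
      by move=> y _; exact: norm_continuous.
    have M1 := clO1 _ cB (MO1 (M + 1) (ltac:(by rewrite ltrDl) : M < M + 1)).
    exists (M + 1); split; first exact: num_real.
    by move=> N MN y /M1/= /le_trans; apply; exact: ltW.
  - exact: continuous_subspaceT.
  rewrite inE => clx0; exists x0; split => // y cly; apply: x0min; exact/mem_set.
have wx0_lt0 : w x0 < 0.
  by apply: le_lt_trans wx0; apply: x0min; exact: subset_closure.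
have [x0n x0l] : 0 <= lst_coord x0 /\ fst_coord x0 <= lambda.
  split.
    apply: (clO1 [set y | 0 <= lst_coord y] _ _ _ clx0); last by move=> y /O1[].
    rewrite (_ : mkset _ = (fun y : 'rV[R]_n.+2 => y ord0 ord_max) @^-1` [set t : R | 0 <= t])//.
    apply: preimage_closed; last exact: closed_ge.
    by move=> y _; exact: coord_continuous.
  apply: (clO1 [set y | fst_coord y <= lambda] _ _ _ clx0); last first.
    by move=> y /O1[_ /andP[_ /ltW]].
  rewrite (_ : mkset _ = (fun y : 'rV[R]_n.+2 => y ord0 ord0) @^-1` [set t : R | t <= lambda])//.
  apply: preimage_closed; last exact: closed_le.
  by move=> y _; exact: coord_continuous.
(* The closure only gives the weak inequality; equality is excluded because [w] vanishes on the
   hyperplane. *)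
have Hx0 : Hlt lambda x0.
  rewrite /Hlt/= lt_neqAle x0l andbT; apply/eqP => /w0; lra.
(* Outside [Omega1], a point of the half space with nonnegative last coordinate is not in [Omega2]
   either, so [w] is nonnegative there. *)
have O1x0 : Omega1 x0.
  apply: contrapT => nO1; move: wx0_lt0; rewrite ltNge => /negP; apply.
  by apply: wge0; split => // -[//|/O2[_]]; lra.
have upper_min y : Hlt lambda y -> 0 <= lst_coord y -> w x0 <= w y.
  move=> Hy yn; have [yO1|yNO1] := pselect (Omega1 y).
    by apply: x0min; exact: subset_closure.
  apply: (le_trans (ltW wx0_lt0)); apply: wge0; split => // -[//|/O2[_]]; lra.
(* On [Omega2] the normal derivative condition transfers the bound [w x0], already known for
   nonnegative last coordinate, to negative last coordinate. *)
have xmin y : Hlt lambda y -> w x0 <= w y.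
  move=> Hy; have [yn|yn] := leP 0 (lst_coord y); first exact: upper_min.
  have [yO2|yNO2] := pselect (Omega2 y).
    apply: (nonlocal_normal_ge0_lower_bound alpha_gt0 wanti c_gt0 wL w0 Hy yn) (normal _ yO2).
      exact: ltW.
    by move=> z Hz zn; apply: upper_min => //; exact: ltW.
  apply: (le_trans (ltW wx0_lt0)); apply: wge0; split => // -[/O1[]|//]; lra.
have lap_le := frac_laplacian_argmin_le alpha_gt0 wanti c_gt0 htheta wL wC Hx0 wx0_lt0 xmin.
have K_ge := exterior_kernel_ge alpha_gt0 Hx0.
have dl : 0 < lambda - fst_coord x0 < l0.
  by have [_ ] := O1 _ O1x0; lra.
have := l0P _ dl; have := lapl _ O1x0; have am0 := am _ O1x0.
(* What remains is real arithmetic: [F + a0 * w1 <= (c * k * D + m) * w1 < 0], against [Fa]. *)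
move: lap_le K_ge am0 wx0_lt0.
move: (frac_laplacian _ _ _ _) (Rintegral _ _ _) (a x0) (w x0) => F I a0 w1.
move: (_ `^ (- alpha)) ((_ `^ _)^-1) => D k FI kD ma w1lt0 Fa pos.
have h1 : m * w1 >= a0 * w1 by nra.
have h2 : c * (w1 * I) <= c * k * D * w1.
  by rewrite -!mulrA ler_pM2l// mulrA [leRHS]mulrC ler_nM2l.
nra.
Qed.
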